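(* For any shapes schema $\mathbf{S} = (\mathbf{L}, \mathbf{def})$, any stratification $\mathit{strat}$ of $\mathbf{S}$ and any RDF graph $\mathbf{G}$, the stratification-maximal typing $\mathit{Typing}(\mathbf{G}, \mathbf{S}, \mathit{strat})$ is a correct typing of $\mathbf{G}$ by $\mathbf{S}$.
   Context: **RDF graphs.** Let $\mathsf{IRI}$, $\mathsf{Lit}$, $\mathsf{Blank}$ be three pairwise disjoint sets (IRIs, literals, blank nodes). An RDF graph $\mathbf{G}$ is a set of triples $(s,p,o) \in (\mathsf{IRI} \cup \mathsf{Blank}) \times \mathsf{IRI} \times (\mathsf{IRI} \cup \mathsf{Lit} \cup \mathsf{Blank})$. $\mathrm{Nodes}(\mathbf{G})$ is the set of elements occurring as subject ($s$) or object ($o$) of some triple of $\mathbf{G}$. The neighbourhood of a node $n$ is $\mathit{neigh}(n) = \{(s,p,o) \in \mathbf{G} \mid s = n\}$. $N = N_1 \uplus N_2$ means $N = N_1 \cup N_2$ and $N_1 \cap N_2 = \emptyset$ (similarly for $k$ pairwise disjoint sets). **Shapes schemas.** A shapes schema is a pair $\mathbf{S} = (\mathbf{L}, \mathbf{def})$, where $\mathbf{L}$ is a set of shape labels and $\mathbf{def}$ maps every label of $\mathbf{L}$ to a shape expression. Let $\_b$ be a special constant. Shape expressions are given by $S ::= V \mid E \mid S \;\mathsf{AND}\; S \mid S \;\mathsf{OR}\; S \mid \mathsf{NOT}\; S$, where $V$ (a value description) is a subset of $\mathsf{IRI} \cup \mathsf{Lit} \cup \{\_b\}$ and $E$ (a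 neighbourhood description) is a triple expression. Triple expressions are given by $E ::= P\,@L \mid \mathsf{EMPTY} \mid (E \mid E) \mid E\,;E \mid E[\mathit{min};\mathit{max}]$, where $P \subseteq \mathsf{IRI}$, $L \in \mathbf{L}$, $\mathit{min}$ is a natural number and $\mathit{max}$ is a natural number or $*$ (unbounded). Standing assumption: all shape expressions $\mathbf{def}(L)$ are in disjunctive normal form; in particular $\mathsf{NOT}$ is applied only to atomic sub-expressions (value descriptions or triple expressions). **Typings and satisfaction.** A typing of $\mathbf{G}$ by $\mathbf{S}$ is a subset of $\mathrm{Nodes}(\mathbf{G}) \times \mathbf{L}$. For a typing $t$ and a finite or infinite set of triples $N$, the relation $t, N \vDash E$ is defined recursively on $E$: - $t, N \vDash P@L$ iff $N = \{(s,p,o)\}$ is a singleton with $p \in P$ and $(o,L) \in t$; - $t, N \vDash \mathsf{EMPTY}$ iff $N = \emptyset$; - $t, N \vDash E_1 \mid E_2$ iff $t,N \vDash E_1$ or $t,N \vDash E_2$; - $t, N \vDash E_1 ; E_2$ iff $N = N_1 \uplus N_2$ for some $N_1, N_2$ with $t,N_1 \vDash E_1$ and $t,N_2 \vDash E_2$; - $t, N \vDash E[\mathit{min};\mathit{max}]$ iff for some natural $k$ with $\mathit{min} \le k \le \mathit{max}$ (no upper bound if $\mathit{max} = *$), $N = N_1 \uplus \dots \uplus N_k$ with $t, N_j \vDash E$ for all $1 \le j \le k$ ($k=0$ being possible only when $N = \emptyset$). For a node $n$, the relation $t, n \vdash S$ is defined recursively on $S$: - $t, n \vdash V$ iff $n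 \in V$, or $n \in \mathsf{Blank}$ and $\_b \in V$; - $t, n \vdash E$ iff $t, \mathit{neigh}(n) \vDash E$; - $\mathsf{AND}$ and $\mathsf{OR}$ are interpreted as conjunction and disjunction; - $t, n \vdash \mathsf{NOT}\,S$ iff not $t, n \vdash S$. A typing $t$ is a *correct typing* of $\mathbf{G}$ by $\mathbf{S}$ if $t, n \vdash \mathbf{def}(L)$ for every $(n,L) \in t$. **Stratification.** For labels $L_1, L_2$: $\mathit{dep}^-(L_1,L_2)$ holds iff $L_2$ appears in $\mathbf{def}(L_1)$ under an occurrence of $\mathsf{NOT}$; $\mathit{dep}^+(L_1,L_2)$ holds iff $L_2$ appears in $\mathbf{def}(L_1)$ but never under an occurrence of $\mathsf{NOT}$. A stratification of $\mathbf{S}$ with $k$ strata ($k \ge 1$) is a map $\mathit{strat} : \mathbf{L} \to [1;k]$ such that $\mathit{dep}^-(L_1,L_2)$ implies $\mathit{strat}(L_1) > \mathit{strat}(L_2)$, and $\mathit{dep}^+(L_1,L_2)$ implies $\mathit{strat}(L_1) \ge \mathit{strat}(L_2)$. **Stratification-maximal typing.** For $1 \le i \le k$ let $\mathbf{L}_i = \{L \in \mathbf{L} \mid \mathit{strat}(L) \le i\}$ and let $\mathbf{S}_i = (\mathbf{L}_i, \mathbf{def}_i)$ with $\mathbf{def}_i$ the restriction of $\mathbf{def}$ to $\mathbf{L}_i$. For a typing $t$, let $t_{|\mathbf{L}_i} = \{(n,L) \in t \mid L \in \mathbf{L}_i\}$. Define $\mathit{typing}_1$ as the maximal correct typing of $\mathbf{G}$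 by $\mathbf{S}_1$, i.e. the union of all correct typings of $\mathbf{G}$ by $\mathbf{S}_1$; and for $1 \le i < k$, $\mathit{typing}_{i+1}$ as the union of all correct typings $t'$ of $\mathbf{G}$ by $\mathbf{S}_{i+1}$ such that $t'_{|\mathbf{L}_i} = \mathit{typing}_i$. Then $\mathit{Typing}(\mathbf{G},\mathbf{S},\mathit{strat}) = \mathit{typing}_k$. *)

(* Defs.v *)
From mathcomp Require Import all_boot all_classical.
Set Implicit Arguments.
Unset Strict Implicit.
Unset Printing Implicit Defensive.
Local Open Scope classical_set_scope.

(* IRIs, literals and blank nodes are three arbitrary types; their pairwise
   disjointness is obtained by tagging. *)
Inductive term (IRI Lit Blank : Type) : Type :=
  | TIri of IRI
  | TLit of Lit
  | TBlank of Blank.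
Arguments TIri {IRI Lit Blank}.
Arguments TLit {IRI Lit Blank}.
Arguments TBlank {IRI Lit Blank}.

Record triple (IRI Lit Blank : Type) : Type := Triple {
  subj : IRI + Blank;
  prop : IRI;
  obj : term IRI Lit Blank }.

(* The elements of IRI \cup Lit \cup {_b}. *)
Inductive value (IRI Lit : Type) : Type :=
  | ValIri of IRI
  | ValLit of Lit
  | ValBlank.
Arguments ValIri {IRI Lit}.
Arguments ValLit {IRI Lit}.
Arguments ValBlank {IRI Lit}.

(* In [TRepeat E min max], [max = None] stands for the unbounded maximum. *)
Inductive texpr (IRI Label : Type) : Type :=
  | TAtom of set IRI & Label
  | TEmpty
  | TAlt of texpr IRI Label & texpr IRI Label
  | TSeq of texpr IRI Label & texpr IRI Label
  | TRepeat of texpr IRI Label & nat & option nat.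

Inductive shape (IRI Lit Label : Type) : Type :=
  | SValue of set (value IRI Lit)
  | SNeigh of texpr IRI Label
  | SAnd of shape IRI Lit Label & shape IRI Lit Label
  | SOr of shape IRI Lit Label & shape IRI Lit Label
  | SNot of shape IRI Lit Label.

Section Graphs.
Context {IRI Lit Blank : Type}.

Definition graph : Type := set (triple IRI Lit Blank).

Definition subj_term (x : triple IRI Lit Blank) : term IRI Lit Blank :=
  match subj x with
  | inl i => TIri i
  | inr b => TBlank b
  end.

Definition nodes (G : graph) : set (term IRI Lit Blank) :=
  [set n | exists2 x, G x & subj_term x = n \/ obj x = n].

Definition neigh (G : graph) (n : term IRI Lit Blank) :
    set (triple IRI Lit Blank) :=
  [set x | G x /\ subj_term x = n].

End Graphs.
Arguments graph : clear implicits.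

Section Expressions.
Context {IRI Lit Label : Type}.

Fixpoint texpr_labels (E : texpr IRI Label) : set Label :=
  match E with
  | TAtom _ L => [set L]
  | TEmpty => set0
  | TAlt E1 E2 | TSeq E1 E2 => texpr_labels E1 `|` texpr_labels E2
  | TRepeat E1 _ _ => texpr_labels E1
  end.

Fixpoint shape_labels (S : shape IRI Lit Label) : set Label :=
  match S with
  | SValue _ => set0
  | SNeigh E => texpr_labels E
  | SAnd S1 S2 | SOr S1 S2 => shape_labels S1 `|` shape_labels S2
  | SNot S1 => shape_labels S1
  end.

(* Labels with at least one occurrence under a negation. *)
Fixpoint neg_labels (S : shape IRI Lit Label) : set Label :=
  match S with
  | SValue _ | SNeigh _ => set0
  | SAnd S1 S2 | SOr S1 S2 => neg_labels S1 `|` neg_labels S2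
  | SNot S1 => shape_labels S1
  end.

Definition is_atom (S : shape IRI Lit Label) : bool :=
  match S with SValue _ | SNeigh _ => true | _ => false end.

Definition is_literal (S : shape IRI Lit Label) : bool :=
  match S with SNot S1 => is_atom S1 | _ => is_atom S end.

Fixpoint is_conj (S : shape IRI Lit Label) : bool :=
  match S with
  | SAnd S1 S2 => is_conj S1 && is_conj S2
  | _ => is_literal S
  end.

Fixpoint is_dnf (S : shape IRI Lit Label) : bool :=
  match S with
  | SOr S1 S2 => is_dnf S1 && is_dnf S2
  | _ => is_conj S
  end.

End Expressions.

(* The label set is a subset of an ambient type; the values of [def] outside
   of [labels] are irrelevant, so that restricting the schema to fewer labels
   amounts to shrinking [labels]. *)
Record schema (IRI Lit Label : Type) : Type := Schema {
  labels : set Label;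
  def : Label -> shape IRI Lit Label;
  def_labels : forall L, labels L -> shape_labels (def L) `<=` labels }.

Section Typings.
Context {IRI Lit Blank Label : Type}.
Notation node := (term IRI Lit Blank).
Notation triples := (set (triple IRI Lit Blank)).

Definition le_max (k : nat) (max : option nat) : bool :=
  if max is Some m then k <= m else true.

Fixpoint sat_texpr (t : set (node * Label)) (N : triples)
    (E : texpr IRI Label) : Prop :=
  match E with
  | TAtom P L => exists x, [/\ N = [set x], P (prop x) & t (obj x, L)]
  | TEmpty => N = set0
  | TAlt E1 E2 => sat_texpr t N E1 \/ sat_texpr t N E2
  | TSeq E1 E2 => exists N1 N2 : triples,
      [/\ N = N1 `|` N2, N1 `&` N2 = set0, sat_texpr t N1 E1
        & sat_texpr t N2 E2]
  | TRepeat E1 min max => exists k : nat,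
      [/\ min <= k, le_max k max & exists F : 'I_k -> triples,
        [/\ N = \bigcup_(j in setT) F j, trivIset setT F
          & forall j, sat_texpr t (F j) E1]]
  end.

Definition sat_value (n : node) (V : set (value IRI Lit)) : Prop :=
  match n with
  | TIri i => V (ValIri i)
  | TLit l => V (ValLit l)
  | TBlank _ => V ValBlank
  end.

Fixpoint sat_shape (G : graph IRI Lit Blank) (t : set (node * Label))
    (n : node) (S : shape IRI Lit Label) : Prop :=
  match S with
  | SValue V => sat_value n V
  | SNeigh E => sat_texpr t (neigh G n) E
  | SAnd S1 S2 => sat_shape G t n S1 /\ sat_shape G t n S2
  | SOr S1 S2 => sat_shape G t n S1 \/ sat_shape G t n S2
  | SNot S1 => ~ sat_shape G t n S1
  end.

Definition is_typing (G : graph IRI Lit Blank) (S : schema IRI Lit Label)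
    (t : set (node * Label)) : Prop :=
  t `<=` nodes G `*` labels S.

Definition correct_typing (G : graph IRI Lit Blank) (S : schema IRI Lit Label)
    (t : set (node * Label)) : Prop :=
  is_typing G S t /\ forall n L, t (n, L) -> sat_shape G t n (def S L).

End Typings.

Section Stratification.
Context {IRI Lit Blank Label : Type}.
Implicit Types (S : schema IRI Lit Label) (G : graph IRI Lit Blank).

Definition dep_neg S (L1 L2 : Label) : Prop :=
  labels S L1 /\ neg_labels (def S L1) L2.

Definition dep_pos S (L1 L2 : Label) : Prop :=
  [/\ labels S L1, shape_labels (def S L1) L2 & ~ neg_labels (def S L1) L2].

(* Only the values of [strat] on [labels S] are relevant. *)
Record stratification S (k : nat) : Type := Stratification {
  strat :> Label -> nat;
  strata_gt0 : 1 <= k;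
  strat_range : forall L, labels S L -> 1 <= strat L <= k;
  strat_neg : forall L1 L2, dep_neg S L1 L2 -> strat L1 > strat L2;
  strat_pos : forall L1 L2, dep_pos S L1 L2 -> strat L1 >= strat L2 }.

Definition strat_labels S k (st : stratification S k) (i : nat) : set Label :=
  [set L | labels S L /\ st L <= i].

Lemma strat_labels_closed S k (st : stratification S k) i L :
  strat_labels st i L -> shape_labels (def S L) `<=` strat_labels st i.
Proof.
move=> [SL leLi] L' defL'; split; first exact: def_labels SL _ defL'.
apply: leq_trans leLi; case: (pselect (neg_labels (def S L) L')) => negL'.
  by apply: ltnW; apply: (strat_neg st).
exact: (strat_pos st).
Qed.

Definition strat_schema S k (st : stratification S k) (i : nat) :
    schema IRI Lit Label :=
  Schema (@strat_labels_closed S k st i).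

Definition typing_restrict (t : set (term IRI Lit Blank * Label))
    (Ls : set Label) : set (term IRI Lit Blank * Label) :=
  [set x | t x /\ Ls x.2].

(* Strata are numbered from 1: [typing_succ G st i] is the typing for the
   stratum [i.+1]. *)
Fixpoint typing_succ G S k (st : stratification S k) (i : nat) :
    set (term IRI Lit Blank * Label) :=
  match i with
  | 0 => \bigcup_(t in [set t | correct_typing G (strat_schema st 1) t]) t
  | j.+1 => \bigcup_(t in [set t | correct_typing G (strat_schema st j.+2) t /\
        typing_restrict t (strat_labels st j.+1) = typing_succ G st j]) t
  end.

Definition Typing G S k (st : stratification S k) :
    set (term IRI Lit Blank * Label) :=
  typing_succ G st k.-1.

End Stratification.

(* Main.v *)
Require Import Defs.
From mathcomp Require Import all_boot all_classical.

(** Satisfaction is monotone in the typing, provided the typing does not change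
    on the labels occurring under a negation.  In a family of correct typings
    of one stratum that agree on the lower strata, such labels lie in the lower
    strata, so what a member of the family satisfies is still satisfied by the
    union of the family. *)

Local Open Scope classical_set_scope.

Section Monotonicity.
Context {IRI Lit Blank Label : Type}.
Implicit Types t u : set (term IRI Lit Blank * Label).

Lemma sat_texpr_mono t u (E : texpr IRI Label) N :
  (forall n L, texpr_labels E L -> t (n, L) -> u (n, L)) ->
  sat_texpr t N E -> sat_texpr u N E.
Proof.
elim: E N => [P L||E1 IH1 E2 IH2|E1 IH1 E2 IH2|E1 IH1 m M] //= N tu.
- by move=> [x [NE Px tx]]; exists x; split=> //; apply: tu.
- by move=> [/IH1|/IH2] h; [left|right]; apply: h => n L EL; apply: tu;
    [left|right].
- move=> [N1 [N2 [NE N12 /IH1 h1 /IH2 h2]]]; exists N1, N2; split=> //.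
  + by apply: h1 => n L EL; apply: tu; left.
  + by apply: h2 => n L EL; apply: tu; right.
- move=> [k [mk kM [F [NE Ftriv FE]]]]; exists k; split=> //.
  by exists F; split=> // j; apply: IH1.
Qed.

Lemma neg_labels_sub (S : Defs.shape IRI Lit Label) :
  neg_labels S `<=` shape_labels S.
Proof.
by elim: S => [V|E|S1 IH1 S2 IH2|S1 IH1 S2 IH2|S1 _] //=; apply: setUSS.
Qed.

Lemma sat_shape_mono (G : graph IRI Lit Blank) t u n
    (S : Defs.shape IRI Lit Label) :
  (forall m L, shape_labels S L -> t (m, L) -> u (m, L)) ->
  (forall m L, neg_labels S L -> u (m, L) -> t (m, L)) ->
  sat_shape G t n S -> sat_shape G u n S.
Proof.
elim: S t u => [V|E|S1 IH1 S2 IH2|S1 IH1 S2 IH2|S1 IH1] t u //= tu ut.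
- exact: sat_texpr_mono.
- by move=> [h1 h2]; split; [apply: IH1 h1|apply: IH2 h2] => m L SL;
    (apply: tu || apply: ut); (by left) || (by right).
- by move=> [h1|h2]; [left; apply: IH1 h1|right; apply: IH2 h2] => m L SL;
    (apply: tu || apply: ut); (by left) || (by right).
(* Negation swaps the roles of [t] and [u]. Every label of [S1] counts as negative here, so [ut]
   supplies the inclusion now required on all its labels. *)
- move=> nt us; apply: nt; apply: IH1 us => // m L /neg_labels_sub.
  exact: tu.
Qed.

(** Leaving [r] arbitrary lets one argument serve the lowest stratum, with [r] empty, and each later
    one, with [r] the preceding typing. *)
Lemma correct_typing_bigcup (G : graph IRI Lit Blank) (S : schema IRI Lit Label)
    k (st : stratification S k) i (r : set (term IRI Lit Blank * Label))
    (T : set (set (term IRI Lit Blank * Label))) :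
  (forall t, T t -> correct_typing G (strat_schema st i.+1) t) ->
  (forall t, T t -> typing_restrict t (strat_labels st i) = r) ->
  correct_typing G (strat_schema st i.+1) (\bigcup_(t in T) t).
Proof.
move=> Tc Tr; split=> [x [t Tt tx]|n L [t Tt tnL]].
  by have [tG _] := Tc t Tt; apply: tG.
have [tG tsat] := Tc t Tt; have /= [_ [SL stL]] := tG _ tnL.
apply: sat_shape_mono (tsat n L tnL) => m L' /= defL'.
  by exists t.
(* A label negated in [def S L] has stratum at most [i], where [t'] and [t] both restrict to [r]; so
   the pair passes from [t'] to [t]. *)
move=> [t' Tt' t'mL'].
suff [] : typing_restrict t (strat_labels st i) (m, L') by [].
rewrite (Tr t Tt) -(Tr t' Tt'); split=> //=; split.
  exact: def_labels SL _ (neg_labels_sub _ _ defL').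
by rewrite -ltnS (leq_trans _ stL) //; apply: (strat_neg st).
Qed.

Lemma typing_succ_correct (G : graph IRI Lit Blank) (S : schema IRI Lit Label)
    k (st : stratification S k) i :
  correct_typing G (strat_schema st i.+1) (typing_succ G st i).
Proof.
case: i => [|i] /=; last first.
  by apply: (@correct_typing_bigcup _ _ _ _ _ (typing_succ G st i)) => t [].
(* Strata start at 1, so no label has stratum at most 0 and every restriction is empty. *)
apply: (@correct_typing_bigcup _ _ _ _ _ set0) => // t _.
apply/seteqP; split=> // x [_ [SL]]; rewrite leqNgt.
by have /andP[->] := strat_range st SL.
Qed.

End Monotonicity.

Theorem proposition1 (IRI Lit Blank Label : Type) (S : schema IRI Lit Label)
    (S_dnf : forall L : Label, labels S L -> is_dnf (def S L))
    (k : nat) (st : stratification S k) (G : graph IRI Lit Blank) :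
  correct_typing G S (Typing G st).
Proof.
have [tG tsat] := typing_succ_correct G S k st k.-1.
(* [strat_schema] shares [def] with [S], so satisfaction carries over unchanged; only the bound on
   the stratum is dropped. *)
by split=> // x /tG[Gx [Sx _]].
Qed.
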